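(* Let $(V,\omega)$ be an $n$-dimensional multisymplectic vector space of degree $k+1$, and let $U$, $W$ be any linear subspaces of $V$. Then for any $1\leq l\leq n$ and any $1\leq r\leq k$: (1) $\{0\}_{II}^{\perp,l}=G^lV$. (2) $\omega$ is $r$-nondegenerate if and only if $V_{II}^{\perp,r}=\{0\}$. (3) If $\omega|_W$ is $r$-nondegenerate (as a form on $W$), then $G^rW\cap W_{II}^{\perp,r}=\{0\}$. (4) $\omega|_W$ is fully nondegenerate (as a form on $W$) if and only if $G^kW\cap W_{II}^{\perp,k}=\{0\}$. (5) $W_{II}^{\perp,l}=G^lV$ if $l\geq k+1$. (6) If $U\subseteq W$, then $W_{II}^{\perp,l}\subseteq U_{II}^{\perp,l}$. (7) $(U+W)_{II}^{\perp,l}=U_{II}^{\perp,l}\cap W_{II}^{\perp,l}$.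
   Context: Vector spaces are real. A multisymplectic vector space of degree $k+1$ (with $k\ge 1$) is a pair $(V,\omega)$ with $V$ an $n$-dimensional vector space and $\omega$ an exterior $(k+1)$-form on $V$ such that $v\lrcorner\omega=0$ iff $v=0$, for $v\in V$. Contraction: $(v_1\wedge\cdots\wedge v_r)\lrcorner\omega=\omega(v_1,\ldots,v_r,\cdot,\ldots,\cdot)$, a form of degree $k+1-r$, understood to be $0$ if $r>k+1$. For a subspace $W\subseteq V$, $G^lW=\{w_1\wedge\cdots\wedge w_l:w_i\in W\}$ is the set of decomposable $l$-multivectors (it always contains $0$). An exterior $(k+1)$-form $\omega$ on a vector space $V$ is $r$-nondegenerate if for all $v_1\wedge\cdots\wedge v_r\in G^rV$: $(v_1\wedge\cdots\wedge v_r)\lrcorner\omega=0$ if and only if $v_1\wedge\cdots\wedge v_r=0$. It is fully nondegenerate if it is $k$-nondegenerate. The Type-II $l$-th orthogonal complement of $W$, $1\le l\le n$, is $W_{II}^{\perp,l}=\{v_1\wedge\cdots\wedge v_l\in G^lV:(v_1\wedge\cdots\wedge v_l\wedge w)\lrcorner\omega=0\text{ for all }w\in W\}$. *)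

(* Defs.v *)
From HB Require Import structures.
From mathcomp Require Import all_boot all_order all_algebra.
From mathcomp Require Import boolp functions classical_sets reals.
From mathcomp Require Import freeg fintype.

Set Implicit Arguments.
Unset Strict Implicit.
Unset Printing Implicit Defensive.

Import GRing.Theory.
Local Open Scope ring_scope.

Definition upd (T : Type) l (v : T ^ l) (i : 'I_l) (x : T) : T ^ l :=
  [ffun j => if j == i then x else v j].

Definition rconsf (T : Type) l (v : T ^ l) (w : T) : T ^ l.+1 :=
  [ffun i => oapp v w (unlift ord_max i)].

(* v followed by u; the lengths are written r and m - r because a contraction
   of an m-form by an r-multivector has degree m - r *)
Definition catf (T : Type) r m (le_rm : (r <= m)%N) (v : T ^ r) (u : T ^ (m - r)) :
    T ^ m :=
  [ffun i : 'I_m => match split (cast_ord (esym (subnKC le_rm)) i) with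
                    | inl j => v j
                    | inr j => u j
                    end].

Section TupleTheory.
Variable T : Type.

Lemma updE l (v : T ^ l) i x : upd v i x i = x.
Proof. by rewrite ffunE eqxx. Qed.

Lemma upd_neq l (v : T ^ l) i j x : j != i -> upd v i x j = v j.
Proof. by rewrite ffunE => /negPf ->. Qed.

Lemma rconsf_lift l (v : T ^ l) w i : rconsf v w (lift ord_max i) = v i.
Proof. by rewrite ffunE liftK. Qed.

Lemma rconsf_max l (v : T ^ l) w : rconsf v w ord_max = w.
Proof. by rewrite ffunE unlift_none. Qed.

Lemma rconsf_upd l (v : T ^ l) i x w :
  rconsf (upd v i x) w = upd (rconsf v w) (lift ord_max i) x.
Proof.
apply/ffunP => j; case: (unliftP ord_max j) => [k|] ->.
  rewrite rconsf_lift; have [->|ki] := eqVneq k i; first by rewrite !updE.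
  by rewrite !upd_neq ?rconsf_lift ?(inj_eq lift_inj).
by rewrite upd_neq ?rconsf_max ?neq_lift.
Qed.

Variables (r m : nat) (le_rm : (r <= m)%N).
Let e := subnKC le_rm.

Lemma catfl (v : T ^ r) u j : catf le_rm v u (cast_ord e (lshift _ j)) = v j.
Proof.
rewrite ffunE cast_ordK -[lshift _ j]/(unsplit (inl j)).
by rewrite (unsplitK (inl j : 'I_r + 'I_(m - r))).
Qed.

Lemma catfr (v : T ^ r) u j : catf le_rm v u (cast_ord e (rshift _ j)) = u j.
Proof.
rewrite ffunE cast_ordK -[rshift _ j]/(unsplit (inr j)).
by rewrite (unsplitK (inr j : 'I_r + 'I_(m - r))).
Qed.

Lemma catf_updl (v : T ^ r) u i x :
  catf le_rm (upd v i x) u = upd (catf le_rm v u) (cast_ord e (lshift _ i)) x.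
Proof.
apply/ffunP => j; rewrite -[j](cast_ordKV e).
case: (split_ordP (cast_ord (esym e) j)) => k ->.
  rewrite catfl; have [->|ki] := eqVneq k i; first by rewrite !updE.
  by rewrite !upd_neq ?catfl // (inj_eq (@cast_ord_inj _ _ _)) eq_lshift.
by rewrite upd_neq ?catfr // (inj_eq (@cast_ord_inj _ _ _)) eq_rlshift.
Qed.

Lemma catf_updr (v : T ^ r) u i x :
  catf le_rm v (upd u i x) = upd (catf le_rm v u) (cast_ord e (rshift _ i)) x.
Proof.
apply/ffunP => j; rewrite -[j](cast_ordKV e).
case: (split_ordP (cast_ord (esym e) j)) => k ->.
  by rewrite upd_neq ?catfl // (inj_eq (@cast_ord_inj _ _ _)) eq_lrshift.
rewrite catfr; have [->|ki] := eqVneq k i; first by rewrite !updE.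
by rewrite !upd_neq ?catfr // (inj_eq (@cast_ord_inj _ _ _)) eq_rshift.
Qed.

End TupleTheory.

Section AltMap.
Variables (R : comNzRingType) (V M : lmodType R) (l : nat).

Definition multilinear (f : V ^ l -> M) :=
  forall (v : V ^ l) i (a : R) (x y : V),
    f (upd v i (a *: x + y)) = a *: f (upd v i x) + f (upd v i y).

Definition alternating (f : V ^ l -> M) :=
  forall (v : V ^ l) i j, i != j -> v i = v j -> f v = 0.

Definition altmap_pred : {pred V ^ l -> M} :=
  fun f => `[< multilinear f /\ alternating f >].

Lemma altmap_submod_closed : submod_closed altmap_pred.
Proof.
split; first by apply/asboolP; split=> [v i a x y|//]; rewrite scaler0 addr0.
move=> c f g /asboolP[fm fa] /asboolP[gm ga]; apply/asboolP; split.
  move=> v i a x y; rewrite /= !fctE fm gm !scalerDr !scalerA mulrC.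
  by rewrite addrACA.
by move=> v i j ij vij; rewrite !fctE (fa _ _ _ ij vij) (ga _ _ _ ij vij)
  scaler0 addr0.
Qed.

HB.instance Definition _ :=
  GRing.isSubmodClosed.Build R _ altmap_pred altmap_submod_closed.

Record altmap := AltMap { altmap_fun :> V ^ l -> M; _ : altmap_fun \in altmap_pred }.
HB.instance Definition _ := [isSub for altmap_fun].
HB.instance Definition _ := [Choice of altmap by <:].
HB.instance Definition _ := [SubChoice_isSubLmodule of altmap by <:].

Lemma altmapP (f : altmap) : multilinear f /\ alternating f.
Proof. by case: f => f /= /asboolP. Qed.

Lemma altmap_inP (f : V ^ l -> M) : multilinear f -> alternating f ->
  f \in altmap_pred.
Proof. by move=> fm fa; apply/asboolP. Qed.

Lemma altmap_eq (f g : altmap) : f =1 g -> f = g.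
Proof. by move=> fg; apply/val_inj/funext. Qed.

Lemma altmap0E v : (0 : altmap) v = 0. Proof. by []. Qed.
Lemma altmapDE (f g : altmap) v : (f + g) v = f v + g v. Proof. by []. Qed.
Lemma altmapZE a (f : altmap) v : (a *: f) v = a *: f v. Proof. by []. Qed.

End AltMap.

Notation extform V := (altmap V (GRing.regular _)).

(* The l-th exterior power of V: the free module on V ^ l modulo the submodule
   spanned by the multilinearity and alternation relations. *)
Section ExtPow.
Variables (R : comNzRingType) (V : lmodType R) (l : nat).
Local Notation F := {freeg (V ^ l) / R}.
Local Notation gen v := (<< (v : V ^ l) >> : F).

Inductive ext_rel : F -> Prop :=
| ExtRel0 : ext_rel 0
| ExtRelP a D E : ext_rel D -> ext_rel E -> ext_rel (a *: D + E)
| ExtRelLin (v : V ^ l) i (a : R) (x y : V) :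
    ext_rel (gen (upd v i (a *: x + y)) - (a *: gen (upd v i x) + gen (upd v i y)))
| ExtRelAlt (v : V ^ l) i j : i != j -> v i = v j -> ext_rel (gen v).

Definition ext_relb : {pred F} := fun D => `[< ext_rel D >].

Lemma ext_rel_submod : submod_closed ext_relb.
Proof.
split; first exact/asboolP/ExtRel0.
by move=> a D E /asboolP rD /asboolP rE; apply/asboolP/ExtRelP.
Qed.

HB.instance Definition _ :=
  GRing.isSubmodClosed.Build R _ ext_relb ext_rel_submod.


Definition extpow := ring_quotient.Quotient.quot ext_relb.
HB.instance Definition _ := GRing.Zmodule.on extpow.
HB.instance Definition _ := Quotient.on extpow.

Definition extpow_pi (D : F) : extpow := \pi_extpow%qT D.

Lemma extpow_piE D E : (extpow_pi D == extpow_pi E) = (D - E \in ext_relb).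
Proof. by rewrite /extpow_pi ring_quotient.Quotient.idealrBE. Qed.

Lemma extpow_piD D E : extpow_pi (D + E) = extpow_pi D + extpow_pi E.
Proof. exact: ring_quotient.Quotient.pi_add. Qed.

Lemma extpow_pi_repr (X : extpow) : extpow_pi (repr X) = X.
Proof. exact: reprK. Qed.

Definition extscale (a : R) (X : extpow) : extpow := extpow_pi (a *: repr X).

Lemma extpow_piZ a D : extpow_pi (a *: D) = extscale a (extpow_pi D).
Proof.
apply/eqP; rewrite extpow_piE -scalerBr rpredZ //.
by rewrite -extpow_piE extpow_pi_repr.
Qed.

Lemma extscaleA a b X : extscale a (extscale b X) = extscale (a * b) X.
Proof. by rewrite -[X]extpow_pi_repr -!extpow_piZ scalerA. Qed.

Lemma extscale1 : left_id 1 extscale.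
Proof. by move=> X; rewrite -[X]extpow_pi_repr -extpow_piZ scale1r. Qed.

Lemma extscaleDr : right_distributive extscale +%R.
Proof.
move=> a X Y; rewrite -[X]extpow_pi_repr -[Y]extpow_pi_repr.
by rewrite -extpow_piD -!extpow_piZ -extpow_piD scalerDr.
Qed.

Lemma extscaleDl X : {morph extscale^~ X : a b / a + b}.
Proof.
by move=> a b /=; rewrite -[X]extpow_pi_repr -!extpow_piZ -extpow_piD scalerDl.
Qed.

HB.instance Definition _ := GRing.Zmodule_isLmodule.Build R extpow
  extscaleA extscale1 extscaleDr extscaleDl.

Lemma extpow_pi_is_linear : linear extpow_pi.
Proof. by move=> a D E; rewrite extpow_piD extpow_piZ. Qed.

HB.instance Definition _ :=
  GRing.isLinear.Build R F extpow _ extpow_pi extpow_pi_is_linear.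

Definition wedge (v : V ^ l) : extpow := extpow_pi (gen v).

Lemma wedge_altmap : (wedge : V ^ l -> extpow) \in @altmap_pred _ _ _ _.
Proof.
apply: altmap_inP => [v i a x y | v i j ij vij].
  rewrite /wedge -linearP; apply/eqP; rewrite extpow_piE.
  exact/asboolP/ExtRelLin.
rewrite -[RHS](linear0 extpow_pi); apply/eqP; rewrite extpow_piE subr0.
exact/asboolP/(ExtRelAlt ij vij).
Qed.

Section Lift.
Variables (M : lmodType R) (f : altmap V M l).

HB.instance Definition _ :=
  GRing.isZmodMorphism.Build F M (fglift f) (@lift_is_additive _ _ _ f).

Lemma fglift_gen v : fglift f (gen v) = f v.
Proof. by rewrite liftU scale1r. Qed.

Lemma fglift_linear : linear (fglift f : F -> M).
Proof.
move=> a D E; rewrite (raddfD (fglift f)) /=; congr (_ + _).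
rewrite -[D]freeg_sumE scaler_sumr !(raddf_sum (fglift f)) scaler_sumr.
apply: eq_bigr => z _; rewrite /= liftU scalerA.
have -> : a *: << coeff z D *g z >> = << a * coeff z D *g z >>.
  by apply/eqP/freeg_eqP => k; rewrite coeffZ !coeffU mulrA.
exact: liftU.
Qed.

Lemma fglift_rel D : ext_rel D -> fglift f D = 0.
Proof.
have [fm fa] := altmapP f.
elim=> [|a {}D E _ D0 _ E0|v i a x y|v i j ij vij].
- by rewrite (raddf0 (fglift f)).
- by rewrite fglift_linear D0 E0 scaler0 addr0.
- rewrite (raddfB (fglift f)) /= fglift_linear !fglift_gen.
  by rewrite fm subrr.
- by rewrite fglift_gen (fa _ _ _ ij vij).
Qed.

Definition extlift (X : extpow) : M := fglift f (repr X).

Lemma extlift_pi D : extlift (extpow_pi D) = fglift f D.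
Proof.
apply/eqP; rewrite -subr_eq0 -(raddfB (fglift f)); apply/eqP/fglift_rel/asboolP.
by have := extpow_piE (repr (extpow_pi D)) D; rewrite extpow_pi_repr eqxx.
Qed.

Lemma extlift_wedge v : extlift (wedge v) = f v.
Proof. by rewrite extlift_pi fglift_gen. Qed.

Lemma extlift_is_linear : linear extlift.
Proof.
move=> a X Y; rewrite -[X]extpow_pi_repr -[Y]extpow_pi_repr -linearP.
by rewrite !extlift_pi fglift_linear.
Qed.

End Lift.
HB.instance Definition _ (M : lmodType R) (f : altmap V M l) :=
  GRing.isLinear.Build R extpow M _ (extlift f) (extlift_is_linear f).

Lemma extpow_ext (M : lmodType R) (f g : {linear extpow -> M}) :
  (forall v, f (wedge v) = g (wedge v)) -> f =1 g.
Proof.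
move=> fg X; rewrite -[X]extpow_pi_repr -[repr X]freeg_sumE !linear_sum.
apply: eq_bigr => v _; have -> : << coeff v (repr X) *g v >> = coeff v (repr X) *: gen v.
  by apply/eqP/freeg_eqP => k; rewrite coeffZ !coeffU mul1r.
by rewrite !linearZ /=; congr (_ *: _); exact: fg.
Qed.

End ExtPow.

Section WedgeContract.
Variables (R : comNzRingType) (V : lmodType R).

Section WedgeVec.
Variables (l : nat) (w : V).

Lemma wedge_rcons_altmap :
  (fun v : V ^ l => wedge (rconsf v w)) \in @altmap_pred R V (extpow V l.+1) l.
Proof.
have /asboolP[wm wa] := @wedge_altmap R V l.+1.
apply: altmap_inP => [v i a x y | v i j ij vij].
  by rewrite !rconsf_upd wm.
apply: (wa _ (lift ord_max i) (lift ord_max j)).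
  by rewrite (inj_eq lift_inj).
by rewrite !rconsf_lift.
Qed.

Definition wedge_vec (X : extpow V l) : extpow V l.+1 :=
  extlift (AltMap wedge_rcons_altmap) X.

Lemma wedge_vecE v : wedge_vec (wedge v) = wedge (rconsf v w).
Proof. exact: extlift_wedge. Qed.

End WedgeVec.

Section Contract.
Variables (r m : nat) (omega : extform V m).

Section Fixed.
Hypothesis le_rm : (r <= m)%N.

Lemma contract_form_altmap (v : V ^ r) :
  (fun u => omega (catf le_rm v u)) \in @altmap_pred R V R^o (m - r).
Proof.
have [om oa] := altmapP omega.
apply: altmap_inP => [u i a x y | u i j ij uij].
  by rewrite !catf_updr om.
apply: (oa _ (cast_ord (subnKC le_rm) (rshift _ i))
             (cast_ord (subnKC le_rm) (rshift _ j))).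
  by rewrite (inj_eq (@cast_ord_inj _ _ _)) eq_rshift.
by rewrite !catfr.
Qed.

Definition contract_form (v : V ^ r) : extform V (m - r) :=
  AltMap (contract_form_altmap v).

Lemma contract_map_altmap :
  contract_form \in @altmap_pred R V (extform V (m - r)) r.
Proof.
have [om oa] := altmapP omega.
apply: altmap_inP => [v i a x y | v i j ij vij]; apply: altmap_eq => u /=.
  by rewrite catf_updl om -!catf_updl.
apply: (oa _ (cast_ord (subnKC le_rm) (lshift _ i))
             (cast_ord (subnKC le_rm) (lshift _ j))).
  by rewrite (inj_eq (@cast_ord_inj _ _ _)) eq_lshift.
by rewrite !catfl.
Qed.

End Fixed.

Definition contract (X : extpow V r) : extform V (m - r) :=
  match pselect (r <= m)%N with
  | left le_rm => extlift (AltMap (contract_map_altmap le_rm)) X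
  | right _ => 0
  end.

Lemma contractE (le_rm : (r <= m)%N) (v : V ^ r) (u : V ^ (m - r)) :
  contract (wedge v) u = omega (catf le_rm v u).
Proof.
rewrite /contract; case: (pselect (is_true (r <= m)%N)) => [le_rm'|nle]; last by case: nle.
by rewrite extlift_wedge /= (bool_irrelevance le_rm' le_rm).
Qed.

Lemma contract_gt X : (m < r)%N -> contract X = 0.
Proof. by rewrite ltnNge /contract; case: (pselect _) => // h; rewrite h. Qed.

Lemma contract_is_linear : linear contract.
Proof.
move=> a X Y; rewrite /contract; case: (pselect (is_true (r <= m)%N)) => [le_rm|_].
  exact: linearP.
by rewrite scaler0 addr0.
Qed.

End Contract.
End WedgeContract.

Notation "X '_|' omega" := (contract omega X)
  (at level 40, no associativity) : ring_scope.

Section Multisymplectic.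
Variables (R : realType) (V : vectType R).
Local Open Scope classical_set_scope.

Definition decomposable (W : {vspace V}) (l : nat) : set (extpow V l) :=
  [set X | exists2 v : V ^ l, (forall i, v i \in W) & X = wedge v].
Arguments decomposable W l _ : clear implicits.

Definition r_nondegenerate (m : nat) (r : nat) (omega : extform V m) : Prop :=
  forall X, decomposable fullv r X -> (X _| omega = 0 <-> X = 0).

Definition fully_nondegenerate (k : nat) (omega : extform V k.+1) : Prop :=
  r_nondegenerate k omega.

Definition multisymplectic (k : nat) (omega : extform V k.+1) : Prop :=
  forall v : V, wedge [ffun _ : 'I_1 => v] _| omega = 0 <-> v = 0.

Definition orthII (m : nat) (omega : extform V m) (W : {vspace V}) (l : nat) :
    set (extpow V l) :=
  [set X | decomposable fullv l X /\
           forall w, w \in W -> wedge_vec w X _| omega = 0].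

Section Restrict.
Variables (m : nat) (omega : extform V m) (W : {vspace V}).

Lemma restrict_altmap :
  (fun v : (subvs_of W) ^ m => omega [ffun i => vsval (v i)])
    \in @altmap_pred R (subvs_of W) R^o m.
Proof.
have [om oa] := altmapP omega.
apply: altmap_inP => [v i a x y | v i j ij vij]; last first.
  by apply: (oa _ i j ij); rewrite !ffunE vij.
have updS z : [ffun j => vsval (upd v i z j)] =
              upd [ffun j => vsval (v j)] i (vsval z).
  by apply/ffunP => j; rewrite !ffunE; case: eqP.
by rewrite !updS linearP om.
Qed.

Definition extform_restrict : extform (subvs_of W) m := AltMap restrict_altmap.

End Restrict.
End Multisymplectic.

Arguments decomposable {R V} W%_VS l%_N _.
Arguments r_nondegenerate {R V m} r%_N omega.
Arguments orthII {R V m} omega W%_VS l%_N _.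

(* Main.v *)
Require Import Defs.
From mathcomp Require Import all_boot all_order all_algebra.
From mathcomp Require Import classical_sets reals.
Local Open Scope classical_set_scope.
Local Open Scope ring_scope.

(** Everything reduces to one description of contraction: for a decomposable
    multivector v of degree r <= m, the form v _| omega vanishes exactly when
    omega vanishes on every m-tuple whose first r entries are v
    ([contract_wedge_eq0P]).  When r < m, applying this to v /\ w for all w in W
    shows that v lies in the orthogonal complement of W exactly when omega
    vanishes on the tuples that start with v and whose next entry is in W
    ([contract_wedge_vec_eq0P]).

    Part (2) is then immediate, since for W = V the last condition is void.
    For (3), a tuple of W that starts with v is one of the tuples just described,
    so orthogonality to W forces v _| omega|_W = 0.  The converse implication
    in (4) holds because, in degree r = k, a tuple that starts with v and
    continues in W has no further entry: it is a tuple of W.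

    Parts (3) and (4) also compare exterior powers of W and of V.  Linear maps
    preserve the vanishing of wedge products ([wedge_map_eq0]); applied to the
    inclusion of W and to a projection onto W, this shows that v_1 /\ ... /\ v_r
    vanishes over W if and only if it vanishes over V ([wedge_vsval_eq0]).

    Parts (1) and (7) come from the linearity of v /\ w in w, part (6) is direct,
    and (5) holds because the multivectors v /\ w have larger degree than omega. *)

Set Implicit Arguments.
Unset Strict Implicit.
Unset Printing Implicit Defensive.
Import GRing.Theory.

(** * Tuples with a prescribed beginning *)

Section Extends.
Variable T : Type.

(** Indices are compared as natural numbers, so that the bounds r and m need not
    be related by a transport. *)
Definition extends r m (v : T ^ r) (t : T ^ m) :=
  forall (i : 'I_m) (j : 'I_r), i = j :> nat -> t i = v j.

Lemma extends_catf r m (le_rm : (r <= m)%N) (v : T ^ r) u :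
  extends v (catf le_rm v u).
Proof.
move=> i j ij; rewrite -(catfl le_rm v u j); congr (catf le_rm v u _).
exact/val_inj.
Qed.

Lemma extendsE r m (le_rm : (r <= m)%N) (v : T ^ r) (t : T ^ m) :
  extends v t -> exists u, t = catf le_rm v u.
Proof.
move=> vt; exists [ffun j => t (cast_ord (subnKC le_rm) (rshift r j))].
apply/ffunP => i; rewrite -[i](cast_ordKV (subnKC le_rm)).
case: (split_ordP (cast_ord (esym (subnKC le_rm)) i)) => j ->.
  by rewrite catfl; apply: vt.
by rewrite catfr ffunE.
Qed.

Lemma extends_rconsf r m (lt_rm : (r < m)%N) (v : T ^ r) w (t : T ^ m) :
  extends (rconsf v w) t <-> extends v t /\ t (Ordinal lt_rm) = w.
Proof.
split=> [vwt|[vt <-] i j ij].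
  split=> [i j ij|]; last by rewrite -(rconsf_max v w); apply: vwt.
  by rewrite -(rconsf_lift v w); apply: vwt; rewrite lift_max.
case: (unliftP ord_max j) ij => [j' ->|->] ij.
  by rewrite rconsf_lift; apply: vt; rewrite ij lift_max.
by rewrite rconsf_max; congr (t _); apply: val_inj.
Qed.

End Extends.

(** * Images of wedge products under linear maps *)

Section Functoriality.
Variables (R : comNzRingType) (V V' : lmodType R) (f : {linear V -> V'}).

Definition mapf l (v : V ^ l) : V' ^ l := [ffun i => f (v i)].

Lemma mapf_upd l (v : V ^ l) i x : mapf (upd v i x) = upd (mapf v) i (f x).
Proof. by apply/ffunP => j; rewrite !ffunE; case: eqP. Qed.

Lemma wedge_map_altmap l :
  (fun v : V ^ l => wedge (mapf v)) \in @altmap_pred R V (extpow V' l) l.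
Proof.
have [wm wa] : multilinear (@wedge R V' l) /\ alternating (@wedge R V' l).
  exact: (altmapP (AltMap (@wedge_altmap R V' l))).
apply: altmap_inP => [v i a x y | v i j ij vij].
  by rewrite !mapf_upd linearP wm.
by apply: (wa _ i j ij); rewrite !ffunE vij.
Qed.

(** The vanishing of a wedge product is a consequence of the defining relations
    of the exterior power; as wedge \o f is again alternating, it factors
    through the exterior power of the source. *)
Lemma wedge_map_eq0 l (v : V ^ l) : wedge v = 0 -> wedge (mapf v) = 0.
Proof.
move=> v0; have := extlift_wedge (AltMap (wedge_map_altmap l)) v.
by rewrite v0 linear0 /= => <-.
Qed.

End Functoriality.

(** * Contraction by decomposable multivectors *)

Section Wedge.
Variables (R : comNzRingType) (V : lmodType R).

Lemma contract0 r m (omega : extform V m) :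
  (0 : extpow V r) _| omega = 0.
Proof. by rewrite -[0](subrr 0) -scaleN1r addrC contract_is_linear scaleN1r addNr. Qed.

Lemma contractD r m (omega : extform V m) (X Y : extpow V r) :
  (X + Y) _| omega = X _| omega + Y _| omega.
Proof. by rewrite -[X]scale1r contract_is_linear !scale1r. Qed.

Lemma wedge_const0 l : (0 < l)%N -> wedge ([ffun=> 0] : V ^ l) = 0.
Proof.
case: l => // l _; have [wm _] := altmapP (AltMap (@wedge_altmap R V l.+1)).
(* multilinearity at 0 = -1 *: 0 + 0 in the first entry *)
have := wm [ffun=> 0] ord0 (-1) 0 0; rewrite /= scaler0 addr0 scaleN1r addNr.
by move <-; congr wedge; apply/ffunP => j; rewrite !ffunE if_same.
Qed.

Lemma wedge_vecD l (u w : V) (v : V ^ l) :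
  wedge_vec (u + w) (wedge v) = wedge_vec u (wedge v) + wedge_vec w (wedge v).
Proof.
have [wm _] := altmapP (AltMap (@wedge_altmap R V l.+1)).
have updm x : upd (rconsf v 0) ord_max x = rconsf v x.
  apply/ffunP => j; case: (unliftP ord_max j) => [k|] ->.
    by rewrite upd_neq ?rconsf_lift // eq_sym neq_lift.
  by rewrite updE rconsf_max.
have := wm (rconsf v 0) ord_max 1 u w.
by rewrite /= !scale1r !updm !wedge_vecE.
Qed.

Lemma wedge_vec0 l (v : V ^ l) : wedge_vec 0 (wedge v) = 0.
Proof.
by apply: (addrI (wedge_vec 0 (wedge v))); rewrite -wedge_vecD !addr0.
Qed.

Lemma contract_wedge_eq0P r m (omega : extform V m) (v : V ^ r) :
  (r <= m)%N ->
  wedge v _| omega = 0 <-> forall t, extends v t -> omega t = 0.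
Proof.
move=> le_rm; split=> [v0 t /(extendsE le_rm)[u ->]|vt].
  by rewrite -contractE v0.
by apply: altmap_eq => u; rewrite contractE vt //; apply: extends_catf.
Qed.

End Wedge.

(** * Orthogonal complements and nondegeneracy *)

Lemma r_nondegenerateP (R : realType) (V : vectType R) r m (omega : extform V m) :
  (r <= m)%N ->
  r_nondegenerate r omega <->
  (forall v : V ^ r, (forall t, extends v t -> omega t = 0) -> wedge v = 0).
Proof.
move=> le_rm; split=> [nd v vt|nd _ [v _ ->]].
  apply/nd; last exact/contract_wedge_eq0P.
  by exists v => // i; rewrite memvf.
split=> [/(contract_wedge_eq0P _ _ le_rm)/nd //|->]; exact: contract0.
Qed.

Section Orthogonal.
Variables (R : realType) (V : vectType R).
Implicit Types (W : {vspace V}).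

(** The tuples extending v /\ w for some w in W are those extending v whose
    entry of index r, the first one after v, is in W. *)
Lemma contract_wedge_vec_eq0P r m (lt_rm : (r < m)%N) (omega : extform V m) W
    (v : V ^ r) :
  (forall w, w \in W -> wedge_vec w (wedge v) _| omega = 0) <->
  (forall t, extends v t -> t (Ordinal lt_rm) \in W -> omega t = 0).
Proof.
split=> [vW t vt tW|vt w wW].
  have := vW _ tW; rewrite wedge_vecE contract_wedge_eq0P //; apply.
  exact/extends_rconsf.
rewrite wedge_vecE contract_wedge_eq0P // => t /(extends_rconsf lt_rm)[vt' tw].
by apply: vt => //; rewrite tw.
Qed.

(** The left side always contains 0, which is decomposable in positive degree,
    so only the inclusion in [set 0] matters. *)
Lemma orthII_trivialP r m (lt_rm : (r < m)%N) (omega : extform V m) W :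
  (0 < r)%N ->
  decomposable W r `&` orthII omega W r = [set 0] <->
  (forall v : V ^ r, (forall i, v i \in W) ->
    (forall t, extends v t -> t (Ordinal lt_rm) \in W -> omega t = 0) ->
    wedge v = 0).
Proof.
move=> r_gt0; split=> [W0 v vW vt|W0].
  have : [set 0] (wedge v); last by [].
  rewrite -W0; split; first by exists v.
  split; first by exists v => // i; rewrite memvf.
  exact/contract_wedge_vec_eq0P.
rewrite eqEsubset; split=> [_ [[v vW ->] [_ /(contract_wedge_vec_eq0P lt_rm)]]|].
  exact: W0.
move=> _ ->; rewrite -(wedge_const0 V r_gt0); split.
  by exists [ffun=> 0] => // i; rewrite ffunE mem0v.
split; first by exists [ffun=> 0] => // i; rewrite memvf.
by move=> w _; rewrite wedge_const0 // /wedge_vec linear0 contract0.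
Qed.

Lemma orthIID m (omega : extform V m) U W l :
  orthII omega (U + W)%VS l = orthII omega U l `&` orthII omega W l.
Proof.
rewrite eqEsubset; split=> [X [dX XUW]|_ [[[v vV ->] vU] [_ vW]]].
  split; split=> // w wW; apply: XUW; apply: subvP wW.
    exact: addvSl.
  exact: addvSr.
split; first by exists v.
by move=> _ /memv_addP[u uU [w wW ->]]; rewrite wedge_vecD contractD vU ?vW ?addr0.
Qed.

Section Restriction.
Variable W : {vspace V}.
Local Notation incl := (mapf (@vsval R V W)).

(** The projection vsproj W is a left inverse of the inclusion of W, so the
    exterior power of W embeds into that of V. *)
Lemma wedge_vsval_eq0 l (v : subvs_of W ^ l) : wedge (incl v) = 0 <-> wedge v = 0.
Proof.
split=> [/(wedge_map_eq0 (vsproj W)) <-|/(wedge_map_eq0 (@vsval R V W)) //].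
by congr wedge; apply/ffunP => i; rewrite !ffunE /= vsvalK.
Qed.

Lemma inclE l (v : V ^ l) : (forall i, v i \in W) ->
  exists v' : subvs_of W ^ l, v = incl v'.
Proof.
move=> vW; exists [ffun i => vsproj W (v i)].
by apply/ffunP => i; rewrite !ffunE /= vsprojK.
Qed.

Lemma extends_incl r m (v : subvs_of W ^ r) (t : subvs_of W ^ m) :
  extends (incl v) (incl t) <-> extends v t.
Proof.
split=> vt i j ij; last by rewrite !ffunE (vt i j ij).
by have := vt i j ij; rewrite !ffunE => /val_inj.
Qed.

End Restriction.

Lemma r_nondegenerate_orthIIP r m (omega : extform V m) :
  (0 < r < m)%N ->
  r_nondegenerate r omega <-> orthII omega fullv r = [set 0].
Proof.
move=> /andP[r_gt0 lt_rm].
have <- : decomposable fullv r `&` orthII omega fullv r = orthII omega fullv r.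
  by apply/setIidr => X [].
have orthP := orthII_trivialP lt_rm omega fullv r_gt0.
have ndP := r_nondegenerateP omega (ltnW lt_rm).
split=> [/ndP nd|/orthP triv].
  by apply/orthP => v _ vt; apply: nd => t vt'; apply: vt vt' _; rewrite memvf.
apply/ndP => v vt; apply: triv => [i|t vt' _]; first by rewrite memvf.
exact: vt vt'.
Qed.

Lemma r_nondegenerate_restrict_orthII r m (omega : extform V m) W :
  (0 < r < m)%N ->
  r_nondegenerate r (extform_restrict omega W) ->
  decomposable W r `&` orthII omega W r = [set 0].
Proof.
move=> /andP[r_gt0 lt_rm] /(r_nondegenerateP _ (ltnW lt_rm)) nd.
apply/(orthII_trivialP lt_rm) => // _ /inclE[v ->] vt.
apply/wedge_vsval_eq0/nd => t /extends_incl vt'.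
by apply: vt vt' _; rewrite ffunE subvsP.
Qed.

(** Orthogonality gives omega t = 0 only for tuples t of V that start in W^k and
    have their entry of index k in W.  As omega has degree k + 1 these are all
    the tuples of W extending v, and that is what makes the converse true in
    degree k and not in lower degrees. *)
Lemma fully_nondegenerate_restrictP k (omega : extform V k.+1) W :
  (0 < k)%N ->
  fully_nondegenerate (extform_restrict omega W) <->
  decomposable W k `&` orthII omega W k = [set 0].
Proof.
move=> k_gt0; split; first by apply: r_nondegenerate_restrict_orthII; rewrite k_gt0 /=.
move=> /(orthII_trivialP (ltnSn k) _ _ k_gt0) triv.
apply/r_nondegenerateP => // v vt.
apply/wedge_vsval_eq0/triv => [i|t vt' tW]; first by rewrite ffunE subvsP.
have /inclE[t' tE] : forall i, t i \in W.
  move=> i; have := ltn_ord i; rewrite ltnS leq_eqVlt => /orP[/eqP ik|lt_ik].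
    by have -> : i = Ordinal (ltnSn k) by apply: val_inj.
  by rewrite (vt' i (Ordinal lt_ik)) // ffunE subvsP.
by rewrite tE in vt' *; apply: (vt t'); apply/extends_incl.
Qed.

End Orthogonal.

Unset Implicit Arguments.

Theorem proposition3p1 (R : realType) (V : vectType R) (n k : nat)
    (hk : (1 <= k)%N) (hn : \dim {:V} = n)
    (omega : extform V k.+1) (homega : multisymplectic omega)
    (U W : {vspace V}) (l r : nat)
    (hl : (1 <= l <= n)%N) (hr : (1 <= r <= k)%N) :
  orthII omega 0%VS l = decomposable fullv l
  /\
  (r_nondegenerate r omega <-> orthII omega fullv r = [set 0])
  /\
  (r_nondegenerate r (extform_restrict omega W) ->
     decomposable W r `&` orthII omega W r = [set 0])
  /\
  (fully_nondegenerate (extform_restrict omega W) <->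
     decomposable W k `&` orthII omega W k = [set 0])
  /\
  ((k.+1 <= l)%N -> orthII omega W l = decomposable fullv l)
  /\
  ((U <= W)%VS -> orthII omega W l `<=` orthII omega U l)
  /\
  orthII omega (U + W)%VS l = orthII omega U l `&` orthII omega W l.
Proof.
have /andP[r_gt0 le_rk] := hr.
split; last split; last split; last split; last split; last split.
- rewrite eqEsubset; split=> [X []//|_ [v vV ->]]; split; first by exists v.
  by move=> w; rewrite memv0 => /eqP ->; rewrite wedge_vec0 contract0.
- by apply: r_nondegenerate_orthIIP; rewrite r_gt0.
- by apply: r_nondegenerate_restrict_orthII; rewrite r_gt0.
- exact: fully_nondegenerate_restrictP.
- move=> lt_kl; rewrite eqEsubset; split=> [X []//|X dX]; split=> // w _.
  by rewrite contract_gt.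
- by move=> UW X [dX XW]; split=> // w wU; apply/XW/(subvP UW).
- exact: orthIID.
Qed.
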